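(* Let $A$ be a regular system of divisors, let $S$ be a nonempty subset of $\mathbb N$, and let $n\in\mathbb N$. Then, as identities of rational functions in $x$, \[ \Phi_{A,S,n}(x)=\prod_{d\in A(n)}\left(x^d-1\right)^{\mu_{A,S}(n/d)}=(-1)^{\varrho_S(n)}\prod_{d\in A(n)}\left(1-x^d\right)^{\mu_{A,S}(n/d)}=\prod_{\substack{d\in A(n)\\ n/d\in S}}\Phi_{A,d}(x). \] Furthermore, \[ \prod_{d\in A(n)}\Phi_{A,S,d}(x)=\prod_{\substack{d\in A(n)\\ n/d\in S}}(x^d-1),\qquad \prod_{d\in A(n)}\Phi_{A,d}(x)=x^n-1. \]
   Context: A regular system of divisors is a family $A=(A(n))_{n\in\mathbb N}$, where each $A(n)$ is a set of positive divisors of $n$, such that: (i) $A(1)=\{1\}$ and $A(mn)=\{de: d\in A(m), e\in A(n)\}$ whenever $\gcd(m,n)=1$; (ii) for every prime power $p^a$ ($a\ge1$) there is a divisor $t=t_A(p^a)$ of $a$ (the type of $p^a$) such that $A(p^{it})=\{1,p^t,p^{2t},\dots,p^{it}\}$ for every $0\le i\le a/t$. The $A$-convolution of $f,g:\mathbb N\to\mathbb C$ is $(f*_Ag)(n)=\sum_{d\in A(n)}f(d)g(n/d)$; $\mu_A$ is the inverse of the constant function $1$ under $*_A$ (it is multiplicative, with $\mu_A(p^a)=-1$ if $t_A(p^a)=a$ and $\mu_A(p^a)=0$ otherwise, for $a\ge 1$). For $j\in\mathbb Z$, $(j,n)_A=\max\{d\in\mathbb N: d\mid j,\ d\in A(n)\}$.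 Let $\zeta_n=e^{2\pi i/n}$. For a nonempty $S\subseteq\mathbb N$ with characteristic function $\varrho_S$, define $\mu_{A,S}(n)=\sum_{d\in A(n)}\mu_A(d)\varrho_S(n/d)$ (equivalently $\sum_{d\in A(n)}\mu_{A,S}(d)=\varrho_S(n)$), and $\Phi_{A,S,n}(x)=\prod_{1\le j\le n,\ (j,n)_A\in S}(x-\zeta_n^j)$, and $\Phi_{A,n}(x)=\Phi_{A,\{1\},n}(x)=\prod_{1\le j\le n,\ (j,n)_A=1}(x-\zeta_n^j)$. *)

(* Defs.v *)
From HB Require Import structures.
From mathcomp Require Import all_boot all_order all_algebra.
From mathcomp Require Export finmap.
From mathcomp Require Import boolp classical_sets reals trigo.
From mathcomp Require Export complex.

Set Implicit Arguments.
Unset Strict Implicit.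
Unset Printing Implicit Defensive.

Import Order.TTheory GRing.Theory Num.Theory.

Local Open Scope fset_scope.
Local Open Scope classical_set_scope.
Local Open Scope ring_scope.

Notation "p %:F" := (@FracField.tofrac _ p) : ring_scope.

(* The positive integers are represented by [nat]; nothing is assumed about
   [A 0], and no value at [0] is ever used for [n > 0]. *)
Definition regular_system (A : nat -> {fset nat}) : Prop :=
  [/\ forall n d : nat, (0 < n)%N -> d \in A n -> (d %| n)%N,
      A 1%N = [fset 1%N],
      forall m n : nat, (0 < m)%N -> (0 < n)%N -> coprime m n ->
        A (m * n)%N = [fset (d * e)%N | d in A m, e in A n]
    & forall p a : nat, prime p -> (0 < a)%N ->
        exists2 t : nat, (t %| a)%N &
          forall i : nat, (i <= a %/ t)%N ->
            A (p ^ (i * t))%N = [fset (p ^ (k * t))%N | k in iota 0 i.+1]].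

Definition Aconv (V : pzSemiRingType) (A : nat -> {fset nat})
    (f g : nat -> V) (n : nat) : V :=
  \sum_(d <- A n) f d * g (n %/ d)%N.

Definition Ainverse_of_one (V : pzSemiRingType) (A : nat -> {fset nat})
    (u : nat -> V) : Prop :=
  forall n : nat, (0 < n)%N ->
    Aconv A u (fun=> 1) n = (n == 1%N)%:R /\
    Aconv A (fun=> 1) u n = (n == 1%N)%:R.

(* Integer-valued, since its values are used as exponents. For a regular system
   the inverse exists over [int] ([mu_AP]) and its image in any ring, such as
   the complex numbers, is the only inverse there ([mu_A_unique]). *)
Definition mu_A (A : nat -> {fset nat}) : nat -> int :=
  xget (fun=> 0) [set u : nat -> int | Ainverse_of_one A u].

Definition gcdA (A : nat -> {fset nat}) (j : int) (n : nat) : nat :=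
  \max_(d <- A n | (d%:Z %| j)%Z) d.

Definition rho (S : set nat) (n : nat) : int := (n \in S)%:R.

Definition mu_AS (A : nat -> {fset nat}) (S : set nat) : nat -> int :=
  Aconv A (mu_A A) (rho S).

Definition zeta (R : realType) (n : nat) : R[i] :=
  (cos (2 * pi / n%:R) +i* sin (2 * pi / n%:R))%C.

Definition Phi_AS (R : realType) (A : nat -> {fset nat}) (S : set nat)
    (n : nat) : {poly R[i]} :=
  \prod_(1 <= j < n.+1 | gcdA A j%:Z n \in S) ('X - (zeta R n ^+ j)%:P).

Definition Phi_A (R : realType) (A : nat -> {fset nat}) (n : nat)
    : {poly R[i]} := Phi_AS R A [set 1%N] n.

Lemma regular_mem (A : nat -> {fset nat}) (n : nat) : regular_system A -> (0 < n)%N ->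
  n \in A n /\ forall d, d \in A n -> (n %/ d)%N \in A n.
Proof.
case=> Adiv A1 AM Ap.
elim/ltn_ind: n => n IH n0.
have [n1|n1] := leqP n 1.
  have -> : n = 1%N by apply/eqP; rewrite eqn_leq n1.
  by rewrite A1; split=> [|d]; rewrite !inE // => /eqP ->.
set p := pdiv n; have pp : prime p by apply: pdiv_prime.
have l0 : (0 < logn p n)%N by rewrite logn_gt0 mem_primes pp n0 pdiv_dvd.
have AP : forall a, (0 < a)%N -> (p ^ a)%N \in A (p ^ a)%N /\
    forall d, d \in A (p ^ a)%N -> (p ^ a %/ d)%N \in A (p ^ a)%N.
  move=> a a0; have [t ta At] := Ap p a pp a0.
  have := At _ (leqnn _); rewrite divnK // => ->; split.
    apply/imfsetP; exists (a %/ t)%N; last by rewrite divnK.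
    suff : (a %/ t)%N \in iota 0 (a %/ t).+1 by [].
    by rewrite mem_iota add0n ltnS leqnn.
  move=> d /imfsetP [k kI ->].
  have ka : (k <= a %/ t)%N.
    by have : k \in iota 0 (a %/ t).+1 by []; rewrite mem_iota add0n ltnS.
  apply/imfsetP; exists (a %/ t - k)%N.
    suff : (a %/ t - k)%N \in iota 0 (a %/ t).+1 by [].
    by rewrite mem_iota add0n ltnS leq_subr.
  rewrite mulnBl divnK // expnB ?prime_gt0 //.
  by rewrite -[leqRHS](divnK ta) leq_mul2r ka orbT.
have en : n = (n`_p * n`_p^')%N by rewrite partnC.
have [q0 m0] : (0 < n`_p)%N /\ (0 < n`_p^')%N by rewrite !part_gt0.
have cqm : coprime n`_p n`_p^' by apply: coprime_partC.
have q1 : (1 < n`_p)%N.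
  by rewrite p_part -{1}(expn0 p) ltn_exp2l ?prime_gt1.
have [qA qd] : (n`_p)%N \in A (n`_p)%N /\
    forall d, d \in A (n`_p)%N -> (n`_p %/ d)%N \in A (n`_p)%N.
  by rewrite p_part; apply: AP.
have [mA md] : (n`_p^')%N \in A (n`_p^')%N /\
    forall d, d \in A (n`_p^')%N -> (n`_p^' %/ d)%N \in A (n`_p^')%N.
  by apply: IH => //; rewrite [ltnRHS]en ltn_Pmull.
have eA := AM _ _ q0 m0 cqm; rewrite -en in eA.
rewrite eA; split.
  by rewrite [X in X \in _]en; apply/imfset2P; exists (n`_p)%N => //;
     exists (n`_p^')%N.
move=> d /imfset2P [x /= xA [y /= yA ->]].
apply/imfset2P; exists (n`_p %/ x)%N; first exact: qd.
exists (n`_p^' %/ y)%N; first exact: md.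
rewrite [X in (X %/ _)%N]en.
have xd := Adiv _ _ q0 xA; have yd := Adiv _ _ m0 yA.
case/dvdnP: xd q0 => u ->; case/dvdnP: yd m0 => v ->.
rewrite !muln_gt0 => /andP [_ y0] /andP [_ x0].
have xy0 : (0 < x * y)%N by rewrite muln_gt0 x0 y0.
by rewrite mulnACA !mulnK.
Qed.

Lemma AconvC (V : comPzSemiRingType) (A : nat -> {fset nat}) (f g : nat -> V)
    (n : nat) : regular_system A -> (0 < n)%N -> Aconv A f g n = Aconv A g f n.
Proof.
move=> regA n0; have [_ Asym] := regular_mem regA n0.
have Adiv : forall d, d \in A n -> (d %| n)%N.
  by case: regA => + _ _ _ d => /(_ n d n0).
have Ainv : forall d, d \in A n -> (n %/ (n %/ d))%N = d.
  move=> d dA; have dn := Adiv d dA.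
  have d0 : (0 < d)%N by apply: dvdn_gt0 dn.
  case/dvdnP: dn => u en; rewrite en mulnK // mulKn //.
  by move: n0; rewrite en muln_gt0 => /andP [].
have pA : perm_eq [seq (n %/ d)%N | d <- A n] (A n).
  apply: uniq_perm; rewrite ?fset_uniq //.
    rewrite map_inj_in_uniq ?fset_uniq // => x y xA yA e.
    by rewrite -(Ainv x xA) e Ainv.
  move=> x; apply/mapP/idP => [[d dA ->]|xA]; first exact: Asym.
  by exists (n %/ x)%N; [exact: Asym | rewrite Ainv].
rewrite /Aconv -(perm_big _ pA) big_map big_seq [RHS]big_seq.
by apply: eq_bigr => d dA; rewrite Ainv // mulrC.
Qed.

Lemma Aconv1E (V : pzSemiRingType) (A : nat -> {fset nat}) (u : nat -> V)
    (n : nat) : regular_system A -> (0 < n)%N ->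
  Aconv A u (fun=> 1) n = u n + \sum_(d <- A n | d != n) u d.
Proof.
move=> regA n0; have [nA _] := regular_mem regA n0.
rewrite /Aconv (eq_bigr u) => [|d _]; last by rewrite mulr1.
by rewrite (bigD1_seq n) ?fset_uniq.
Qed.

Lemma mu_AP (A : nat -> {fset nat}) :
  regular_system A -> Ainverse_of_one A (mu_A A).
Proof.
move=> regA; rewrite /mu_A; case: xgetP => [u _ //|noinv]; exfalso.
pose F := fix F k n : int := if k is k'.+1 then
  (n == 1%N)%:R - \sum_(d <- A n | d != n) F k' d else 0.
have Adiv : forall n d, (0 < n)%N -> d \in A n -> (d %| n)%N by case: regA.
have FE : forall k l n, (0 < n <= k)%N -> (n <= l)%N -> F k n = F l n.
  elim=> [|k IH] [|l] n; do ?by case: n.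
  move=> /andP [n0 nk] nl /=; congr (_ - _).
  rewrite big_seq_cond [RHS]big_seq_cond; apply: eq_bigr => d /andP [dA dn].
  have dvd := Adiv n d n0 dA.
  have ltd : (d < n)%N by rewrite ltn_neqAle dn dvdn_leq.
  apply: IH; last by rewrite -ltnS (leq_trans ltd).
  by rewrite (dvdn_gt0 n0 dvd) -ltnS (leq_trans ltd).
have H n : (0 < n)%N -> Aconv A (fun m => F m m) (fun=> 1) n = (n == 1%N)%:R.
  move=> n0; rewrite Aconv1E //; case: n n0 => // n n0.
  rewrite [F _ _]/= -addrA addrC -[RHS]add0r; congr (_ + _).
  apply/eqP; rewrite addrC subr_eq0; apply/eqP.
  rewrite big_seq_cond [RHS]big_seq_cond; apply: eq_bigr => d /andP [dA dn].
  have dvd := Adiv _ d n0 dA.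
  have ltd : (d < n.+1)%N by rewrite ltn_neqAle dn dvdn_leq.
  by apply: FE => //; rewrite (dvdn_gt0 n0 dvd) /=.
apply: (noinv (fun n => F n n)) => n n0; split; first exact: H.
by rewrite AconvC // H.
Qed.

Lemma mu_A_unique (V : pzRingType) (A : nat -> {fset nat}) (u : nat -> V) :
  regular_system A -> Ainverse_of_one A u ->
  forall n : nat, (0 < n)%N -> u n = (mu_A A n)%:~R.
Proof.
move=> regA uP; have muP := mu_AP regA.
elim/ltn_ind => n IH n0.
have [+ _] := uP n n0; have [+ _] := muP n n0.
rewrite !Aconv1E // => em eu.
apply: (addIr (\sum_(d <- A n | d != n) u d)); rewrite eu.
have -> : \sum_(d <- A n | d != n) u d =
    (\sum_(d <- A n | d != n) mu_A A d)%:~R.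
  rewrite rmorph_sum big_seq_cond [RHS]big_seq_cond.
  apply: eq_bigr => d /andP [dA dn].
  have dvd : (d %| n)%N by case: regA => + _ _ _; apply.
  by apply: IH; rewrite ?(dvdn_gt0 n0) // ltn_neqAle dn dvdn_leq.
by rewrite -rmorphD /= em mulrz_nat.
Qed.

(* Main.v *)
(** Two facts about a regular system, both checked on prime powers and extended
    by multiplicativity, carry the proof: [A d] consists of the elements of
    [A n] dividing [d] whenever [d \in A n], and any two elements of [A n] have
    a common multiple in [A n] dividing their lcm. The first makes
    [A]-convolution associative, so that summing [mu_AS] over [A m] gives [rho].
    With the second, the elements of [A n] dividing [j] are exactly those of
    [A (gcdA A j n)]. Hence [rho S (gcdA A j n)] is the sum of [mu_AS A S e]
    over the [e \in A n] dividing [j]; using it as the exponent of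
    [X - zeta^j] and exchanging the two products gives the first formula, since
    the [X - zeta^j] with [e | j] multiply to [X^(n/e) - 1]. The other
    identities follow by associativity of the convolution, acting on the
    multiplicative group of the field of rational functions. *)

Require Import Defs.
From HB Require Import structures.
From mathcomp Require Import all_boot all_order all_algebra finmap.
From mathcomp Require Import boolp classical_sets reals trigo complex.

Set Implicit Arguments.
Unset Strict Implicit.
Unset Printing Implicit Defensive.

Import Order.TTheory GRing.Theory Num.Theory.

Local Open Scope classical_set_scope.
Local Open Scope ring_scope.

(** * Induction over coprime factors; integer powers in a field *)

Lemma coprime_prod_ind (P : nat -> Prop) :
  P 1%N -> (forall p a, prime p -> (0 < a)%N -> P (p ^ a)%N) ->
  (forall m n, (0 < m)%N -> (0 < n)%N -> coprime m n -> P m -> P n ->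
     P (m * n)%N) ->
  forall n, (0 < n)%N -> P n.
Proof.
move=> P1 Pp PM; elim/ltn_ind=> n IH n0.
have [n1|n1] := leqP n 1.
  by have -> : n = 1%N by apply/eqP; rewrite eqn_leq n1.
have pp : prime (pdiv n) by apply: pdiv_prime.
have l0 : (0 < logn (pdiv n) n)%N by rewrite logn_gt0 mem_primes pp n0 pdiv_dvd.
have q1 : (1 < n`_(pdiv n))%N.
  by rewrite p_part -{1}(expn0 (pdiv n)) ltn_exp2l ?prime_gt1.
rewrite -(partnC (pdiv n) n0); apply: PM; rewrite ?part_gt0 ?coprime_partC //.
  by rewrite p_part; apply: Pp.
by apply: IH; rewrite ?part_gt0 // -[ltnRHS](partnC (pdiv n) n0) ltn_Pmull.
Qed.

Lemma prod_expz (F : fieldType) (I : Type) (r : seq I) (P : pred I) (G : I -> F)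
    (m : int) :
  (\prod_(i <- r | P i) G i) ^ m = \prod_(i <- r | P i) G i ^ m.
Proof.
apply: (big_morph (fun x => x ^ m)) => [x y|]; [exact: expfzMl | exact: exp1rz].
Qed.

Lemma expz_sum (F : fieldType) (I : Type) (r : seq I) (P : pred I) (x : F)
    (f : I -> int) : x != 0 ->
  \prod_(i <- r | P i) x ^ f i = x ^ (\sum_(i <- r | P i) f i).
Proof.
move=> x0; symmetry.
by apply: (big_morph (fun m => x ^ m)) => [m n|];
  [exact: expfzDr | exact: expr0z].
Qed.

(** * Regular systems of divisors, their convolution and [gcdA] *)

Section RegularSystem.
Variables (A : nat -> {fset nat}) (regA : regular_system A).

Lemma regular_dvd n d : (0 < n)%N -> d \in A n -> (d %| n)%N.
Proof. by case: regA => + _ _ _; apply. Qed.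

Lemma regular_gt0 n d : (0 < n)%N -> d \in A n -> (0 < d)%N.
Proof. by move=> n0 /(regular_dvd n0); apply: dvdn_gt0. Qed.

Lemma regular_self n : (0 < n)%N -> n \in A n.
Proof. by move=> n0; case: (regular_mem regA n0). Qed.

Lemma regular_compl n d : (0 < n)%N -> d \in A n -> (n %/ d)%N \in A n.
Proof. by move=> n0; case: (regular_mem regA n0) => _; apply. Qed.

Lemma regular_one n : (0 < n)%N -> 1%N \in A n.
Proof.
by move=> n0; have := regular_compl n0 (regular_self n0); rewrite divnn n0.
Qed.

Lemma regular_coprime m n x : (0 < m)%N -> (0 < n)%N -> coprime m n ->
  reflect (exists d e, [/\ d \in A m, e \in A n & x = d * e]%N)
          (x \in A (m * n)%N).
Proof.
move=> m0 n0 cmn; case: regA => _ _ -> // _.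
apply: (iffP (imfset2P _ _ _ _ _)) => [[d dA [e eA ->]]|[d [e [dA eA ->]]]].
  by exists d, e.
by exists d => //; exists e.
Qed.

Lemma regular_prime_pow p a : prime p -> (0 < a)%N ->
  exists2 t, (t %| a)%N & forall i x, (i <= a %/ t)%N ->
    x \in A (p ^ (i * t))%N <-> exists2 k, (k <= i)%N & x = (p ^ (k * t))%N.
Proof.
case: regA => _ _ _ Ap pp a0; have [t ta At] := Ap p a pp a0.
exists t => // i x ia; rewrite At //; split=> [/imfsetP[k kI ->]|[k ki ->]].
  by exists k => //; have : k \in iota 0 i.+1 by []; rewrite mem_iota.
apply/imfsetP; exists k => //.
by suff : k \in iota 0 i.+1 by []; rewrite mem_iota.
Qed.

(** On a prime power, the type [t] of [p ^ a] describes [A] at every element [p ^ (k * t)] of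
    [A (p ^ a)] too, so both sides compare exponents. For coprime factors, the divisibility splits
    by Gauss's lemma. *)
Lemma regular_sub n d e : (0 < n)%N -> d \in A n ->
  (e \in A d) = (e \in A n) && (e %| d)%N.
Proof.
move=> n0; move: n n0 d e.
apply: coprime_prod_ind => [d e|p a pp a0 d e|m n m0 n0 cmn IHm IHn d e].
- case: regA => _ A1 _ _; rewrite {1}A1 inE => /eqP ->.
  by case eA: (e \in A 1); rewrite //= (regular_dvd _ eA).
- have [t ta At] := regular_prime_pow pp a0.
  have t0 : (0 < t)%N by apply: dvdn_gt0 ta.
  have inj u v : (p ^ (u * t) %| p ^ (v * t))%N = (u <= v)%N.
    by rewrite dvdn_Pexp2l ?prime_gt1 // leq_pmul2r.
  rewrite -(divnK ta) => /(At _ _ (leqnn _)) [k ka ->].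
  apply/idP/andP => [/(At _ _ ka) [i ik ->]|[/(At _ _ (leqnn _)) [i _ ->]]].
    rewrite inj; split=> //; apply/At => //; exists i => //.
    exact: leq_trans ka.
  by rewrite inj => ik; apply/At => //; exists i.
- case/regular_coprime=> // d1 [d2 [d1A d2A ->]].
  have [d1m d2n] := (regular_dvd m0 d1A, regular_dvd n0 d2A).
  have [d10 d20] := (regular_gt0 m0 d1A, regular_gt0 n0 d2A).
  have cd : coprime d1 d2.
    by apply: coprime_dvdl d1m _; apply: coprime_dvdr d2n _.
  apply/regular_coprime/andP => // [[e1 [e2 []]]|[]].
    rewrite (IHm d1) // (IHn d2) // => /andP[e1A e1d] /andP[e2A e2d] ->.
    by split; [apply/regular_coprime => //; exists e1, e2 | rewrite dvdn_mul].
  case/regular_coprime=> // e1 [e2 [e1A e2A ->]] ed.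
  have [e1m e2n] := (regular_dvd m0 e1A, regular_dvd n0 e2A).
  exists e1, e2; rewrite (IHm d1) // (IHn d2) // e1A e2A; split=> //=.
    rewrite -(@Gauss_dvdl e1 d1 d2); first exact: dvdn_trans (dvdn_mulr _ _) ed.
    by apply: coprime_dvdl e1m _; apply: coprime_dvdr d2n _.
  rewrite -(@Gauss_dvdr e2 d1 d2); first exact: dvdn_trans (dvdn_mull _ _) ed.
  by rewrite coprime_sym; apply: coprime_dvdr e2n _; apply: coprime_dvdl d1m _.
Qed.

(** On a prime power, [A n] is a chain under divisibility, so the larger of [d] and [e] serves. For
    coprime factors, the product of the two bounds serves. *)
Lemma regular_ub n d e : (0 < n)%N -> d \in A n -> e \in A n ->
  exists2 f, f \in A n & [/\ (d %| f)%N, (e %| f)%N & (f %| lcmn d e)%N].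
Proof.
move=> n0; move: n n0 d e.
apply: coprime_prod_ind => [d e|p a pp a0 d e|m n m0 n0 cmn IHm IHn d e].
- case: regA => _ -> _ _; rewrite !inE => /eqP -> /eqP ->.
  by exists 1%N; rewrite ?inE.
- have [t ta At] := regular_prime_pow pp a0.
  rewrite -(divnK ta) => dA eA.
  case/(At _ _ (leqnn _)): (dA) => k _ dk.
  case/(At _ _ (leqnn _)): (eA) => l _ el.
  have [kl|/ltnW lk] := leqP k l.
    exists e => //; split; rewrite ?dvdn_lcmr // dk el.
    by rewrite dvdn_exp2l // leq_mul2r kl orbT.
  exists d => //; split; rewrite ?dvdn_lcml // dk el.
  by rewrite dvdn_exp2l // leq_mul2r lk orbT.
- case/regular_coprime=> // d1 [d2 [d1A d2A ->]].
  case/regular_coprime=> // e1 [e2 [e1A e2A ->]].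
  have [f1 f1A [df1 ef1 f1l]] := IHm _ _ d1A e1A.
  have [f2 f2A [df2 ef2 f2l]] := IHn _ _ d2A e2A.
  exists (f1 * f2)%N; first by apply/regular_coprime => //; exists f1, f2.
  split; rewrite ?dvdn_mul // Gauss_dvd; last first.
    apply: coprime_dvdl (regular_dvd m0 f1A) _.
    exact: coprime_dvdr (regular_dvd n0 f2A) cmn.
  have lcmM u v w z : (lcmn u v %| lcmn (u * w) (v * z))%N.
    rewrite dvdn_lcm (dvdn_trans (dvdn_mulr w (dvdnn u)) (dvdn_lcml _ _)).
    exact: dvdn_trans (dvdn_mulr z (dvdnn v)) (dvdn_lcmr _ _).
  rewrite (dvdn_trans f1l (lcmM _ _ _ _)) (dvdn_trans f2l) //.
  by rewrite (mulnC d1) (mulnC e1).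
Qed.

Lemma perm_regular_sub n d : (0 < n)%N -> d \in A n ->
  perm_eq (A d) [seq e <- A n | (e %| d)%N].
Proof.
move=> n0 dA; apply: uniq_perm; rewrite ?filter_uniq ?fset_uniq // => e.
by rewrite mem_filter (regular_sub _ n0 dA) andbC.
Qed.

(** Complementation [d |-> n %/ d] preserves [A n] and reverses divisibility: [e] divides [d]
    exactly when [n %/ d] divides [n %/ e], that is, lies in [A (n %/ e)] by [regular_sub].
    Complementing again inside [A (n %/ e)] gives [d %/ e]. *)
Lemma perm_regular_quotient n e : (0 < n)%N -> e \in A n ->
  perm_eq [seq d <- A n | (e %| d)%N] [seq (e * k)%N | k <- A (n %/ e)%N].
Proof.
move=> n0 eA; have e0 := regular_gt0 n0 eA.
have qA := regular_compl n0 eA; have q0 := regular_gt0 n0 qA.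
have en := regular_dvd n0 eA.
have dK x : (x %| n)%N -> (n %/ (n %/ x))%N = x.
  by move=> xn; rewrite divnA // mulKn.
apply: uniq_perm; first by rewrite filter_uniq ?fset_uniq.
  rewrite map_inj_uniq ?fset_uniq // => x y /eqP.
  by rewrite eqn_pmul2l // => /eqP.
move=> d; rewrite mem_filter; apply/andP/mapP => [[ed dA]|[k kA ->]].
  have dn := regular_dvd n0 dA; have d0 := regular_gt0 n0 dA.
  have cA : (n %/ d)%N \in A (n %/ e)%N.
    rewrite (regular_sub _ n0 qA) (regular_compl n0 dA) /=.
    by rewrite dvdn_divRL // -[X in (_ %| X)%N](divnK dn) dvdn_mul.
  exists (d %/ e)%N; last by rewrite mulnC divnK.
  have := regular_compl q0 cA.
  by rewrite divnAC // dK.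
have kq := regular_dvd q0 kA.
have ekn : (e * k %| n)%N by rewrite mulnC -dvdn_divRL.
have := regular_compl q0 kA; rewrite -divnMA.
rewrite (regular_sub _ n0 qA) => /andP[cA _].
by rewrite dvdn_mulr // -(dK _ ekn) (regular_compl n0 cA).
Qed.

(** The substitution [d = e * k] behind associativity, for any commutative monoid so that it applies
    to sums ([AconvA]) and to products of powers ([prod_expz_Aconv]). *)
Lemma big_regular_divisors (V : Type) (idx : V) (op : Monoid.com_law idx)
    (F : nat -> nat -> V) n : (0 < n)%N ->
  \big[op/idx]_(d <- A n) \big[op/idx]_(e <- A d) F d e =
  \big[op/idx]_(e <- A n) \big[op/idx]_(k <- A (n %/ e)%N) F (e * k)%N e.
Proof.
move=> n0; transitivity
  (\big[op/idx]_(d <- A n) \big[op/idx]_(e <- A n | (e %| d)%N) F d e).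
  rewrite big_seq [RHS]big_seq; apply: eq_bigr => d dA.
  by rewrite (perm_big _ (perm_regular_sub n0 dA)) big_filter.
rewrite (exchange_big_dep predT) //= big_seq [RHS]big_seq.
apply: eq_bigr => e eA.
by rewrite -big_filter (perm_big _ (perm_regular_quotient n0 eA)) big_map.
Qed.

Lemma AconvA (V : pzSemiRingType) (f g h : nat -> V) n : (0 < n)%N ->
  Aconv A f (Aconv A g h) n = Aconv A (Aconv A f g) h n.
Proof.
move=> n0; rewrite /Aconv; symmetry.
under eq_bigr do rewrite mulr_suml.
rewrite big_regular_divisors // big_seq [RHS]big_seq; apply: eq_bigr => e eA.
have e0 := regular_gt0 n0 eA.
by rewrite mulr_sumr; apply: eq_bigr => k _; rewrite mulKn // mulrA divnMA.
Qed.

Lemma eq_Aconv (V : pzSemiRingType) (f f' g g' : nat -> V) n : (0 < n)%N ->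
  (forall d, (0 < d)%N -> f d = f' d) -> (forall d, (0 < d)%N -> g d = g' d) ->
  Aconv A f g n = Aconv A f' g' n.
Proof.
move=> n0 ff gg; rewrite /Aconv big_seq [RHS]big_seq; apply: eq_bigr => d dA.
rewrite ff ?gg ?(regular_gt0 n0 dA) //.
exact: (regular_gt0 n0 (regular_compl n0 dA)).
Qed.

Lemma Aconv_delta_l (V : pzSemiRingType) (f : nat -> V) n : (0 < n)%N ->
  Aconv A (fun d => (d == 1%N)%:R) f n = f n.
Proof.
move=> n0; rewrite /Aconv (bigD1_seq 1%N) ?fset_uniq ?regular_one //=.
rewrite mul1r divn1 big1 ?addr0 // => d /negPf ->; exact: mul0r.
Qed.

Lemma sum_mu_AS (S : set nat) n : (0 < n)%N ->
  \sum_(d <- A n) mu_AS A S d = rho S n.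
Proof.
move=> n0; rewrite -(Aconv_delta_l (rho S)) //.
transitivity (Aconv A (fun=> 1) (mu_AS A S) n).
  by rewrite AconvC // /Aconv; apply: eq_bigr => d _; rewrite mulr1.
rewrite /mu_AS AconvA //; apply: eq_Aconv => // d d0.
by have [] := mu_AP regA d0.
Qed.

Lemma mu_AS1 n : (0 < n)%N -> mu_AS A [set 1%N] n = mu_A A n.
Proof.
move=> n0; rewrite -[RHS]Aconv_delta_l // -AconvC //.
by apply: eq_Aconv => // d _; rewrite /rho; congr (nat_of_bool _)%:R;
   apply/idP/eqP => [/set_mem|->]; [|rewrite in_setE].
Qed.

Lemma gcdA_mem j n : (0 < n)%N ->
  gcdA A j%:Z n \in A n /\ (gcdA A j%:Z n %| j)%N.
Proof.
(* An empty maximum would be 0; this is excluded because 1 lies in [A n] and divides [j]. *)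
move=> n0; suff [g0|//] : gcdA A j%:Z n = 0%N \/
    (gcdA A j%:Z n \in A n /\ (gcdA A j%:Z n %| j)%N).
  have : (1 <= gcdA A j%:Z n)%N.
    by apply: (@leq_bigmax_seq _ _ _ id _ (regular_one n0)); rewrite dvd1z.
  by rewrite g0.
rewrite /gcdA big_seq_cond.
elim/big_ind: _ => [|x y [->|xP] [->|yP]|d /andP[dA dj]].
- by left.
- by left.
- by rewrite max0n; right.
- by rewrite maxn0; right.
- by right; rewrite /maxn; case: ifP.
- by right; split; rewrite // dvdzE in dj *.
Qed.

Lemma dvdn_gcdA j n e : (0 < n)%N -> e \in A n ->
  (e %| gcdA A j%:Z n)%N = (e %| j)%N.
Proof.
move=> n0 eA; have [gA gj] := gcdA_mem j n0.
apply/idP/idP => [eg|ej]; first exact: dvdn_trans eg gj.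
(* [f] is a common multiple of [e] and the gcd that divides their lcm, hence [j]; maximality forces
   it to be the gcd itself. *)
have [f fA [ef gf fl]] := regular_ub n0 eA gA.
have fj : (f %| j)%N by rewrite (dvdn_trans fl) // dvdn_lcm ej.
suff -> : gcdA A j%:Z n = f by [].
apply/eqP; rewrite eqn_leq (dvdn_leq (regular_gt0 n0 fA) gf).
by apply: (@leq_bigmax_seq _ _ _ id _ fA); rewrite dvdzE.
Qed.

Lemma rho_gcdA (S : set nat) j n : (0 < n)%N ->
  rho S (gcdA A j%:Z n) = \sum_(e <- A n | (e %| j)%N) mu_AS A S e.
Proof.
move=> n0; have [gA _] := gcdA_mem j n0.
rewrite -sum_mu_AS ?(regular_gt0 n0 gA) //.
rewrite (perm_big _ (perm_regular_sub n0 gA)) big_filter.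
rewrite big_seq_cond [RHS]big_seq_cond; apply: eq_bigl => e.
by case eA: (e \in A n); rewrite //= dvdn_gcdA.
Qed.

Lemma big_regular_compl (V : Type) (idx : V) (op : Monoid.com_law idx)
    (F : nat -> V) n : (0 < n)%N ->
  \big[op/idx]_(d <- A n) F (n %/ d)%N = \big[op/idx]_(d <- A n) F d.
Proof.
move=> n0; have dK d : d \in A n -> (n %/ (n %/ d))%N = d.
  by move=> dA; rewrite divnA ?mulKn // (regular_dvd n0 dA).
rewrite -(big_map (fun d => n %/ d)%N predT F); apply: perm_big.
apply: uniq_perm; rewrite ?fset_uniq //.
  rewrite map_inj_in_uniq ?fset_uniq // => x y xA yA e.
  by rewrite -(dK x) ?e ?dK.
move=> x; apply/mapP/idP => [[d dA ->]|xA]; first exact: regular_compl.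
by exists (n %/ x)%N; [exact: regular_compl | rewrite dK].
Qed.

(* In additive notation for the multiplicative group of [F], this is
   [f * (g * G) = (g * f) * G]. *)
Lemma prod_expz_Aconv (F : fieldType) (G : nat -> F) (f g : nat -> int) n :
  (0 < n)%N -> (forall d, (0 < d)%N -> G d != 0) ->
  \prod_(d <- A n) (\prod_(e <- A d) G e ^ g (d %/ e)%N) ^ f (n %/ d)%N
  = \prod_(e <- A n) G e ^ Aconv A g f (n %/ e)%N.
Proof.
move=> n0 G0; under eq_bigr do rewrite prod_expz.
rewrite big_regular_divisors // big_seq [RHS]big_seq; apply: eq_bigr => e eA.
have e0 := regular_gt0 n0 eA.
rewrite -expz_sum ?G0 //; apply: eq_bigr => k _.
by rewrite exprz_exp mulKn // divnMA.
Qed.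

End RegularSystem.

(** * Roots of unity *)

Lemma zetaX (R : realType) n k : zeta R n ^+ k =
  (cos (k%:R * (2 * pi / n%:R)) +i* sin (k%:R * (2 * pi / n%:R)))%C.
Proof.
rewrite /zeta; move: (2 * pi / n%:R) => t.
elim: k => [|k IH]; first by rewrite mul0r cos0 sin0.
rewrite exprSr IH -natr1 mulrDl mul1r cosD sinD.
apply/eqP; rewrite eq_complex /=; apply/andP; split; apply/eqP.
  by rewrite mulrC [X in _ - X]mulrC.
by rewrite addrC mulrC [X in _ + X]mulrC.
Qed.

Lemma prim_root_zeta (R : realType) n :
  (0 < n)%N -> n.-primitive_root (zeta R n).
Proof.
move=> n0; have nR0 : (0 : R) < n%:R by rewrite ltr0n.
have zn : zeta R n ^+ n = 1.
  rewrite zetaX mulrCA mulfV ?gt_eqF // mulr1 mulrC mulr_natr.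
  by rewrite cos2pi sin2pi.
have [m mp mn] := prim_order_exists n0 zn.
suff nm : n = m by rewrite {1}nm.
apply/eqP; rewrite eqn_leq [(m <= n)%N]dvdn_leq // andbT leqNgt.
apply/negP => lt_mn.
have m0 := prim_order_gt0 mp.
have /eqP := prim_expr_order mp.
rewrite zetaX eq_complex /= => /andP[/eqP cm _].
(* Half the angle of [zeta R n ^+ m]. Since [0 < m < n], it lies strictly between 0 and pi, so its
   sine is positive, whereas [cos (y *+ 2) = 1] forces the sine to vanish. *)
pose y : R := m%:R * pi / n%:R.
have yE : m%:R * (2 * pi / n%:R) = y *+ 2.
  by rewrite /y -[RHS]mulr_natl !mulrA [_ * 2]mulrC.
have sy : 0 < sin y.
  apply: sin_gt0_pi; rewrite /y divr_gt0 ?mulr_gt0 ?pi_gt0 ?ltr0n //=.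
  by rewrite ltr_pdivrMr // [ltRHS]mulrC ltr_pM2r ?pi_gt0 // ltr_nat.
have := cos2Dsin2 y; move: cm; rewrite yE cos_mulr2n => /eqP.
rewrite subr_eq -[1 + 1]/(1 *+ 2) eqr_pMn2r // => /eqP ->.
by move/eqP; rewrite -subr_eq0 addrAC subrr add0r expf_eq0 gt_eqF.
Qed.

Lemma prod_prim_root_dvd (F : fieldType) n e (z : F) :
  (0 < n)%N -> n.-primitive_root z -> (e %| n)%N ->
  \prod_(1 <= j < n.+1 | (e %| j)%N) ('X - (z ^+ j)%:P) = 'X^(n %/ e) - 1.
Proof.
move=> n0 zp en; have e0 := dvdn_gt0 n0 en.
set q := (n %/ e)%N; have qp : q.-primitive_root (z ^+ e).
  have -> : e = (n %/ q)%N by rewrite /q divnA // mulKn.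
  by apply: dvdn_prim_root => //; apply/dvdnP; exists e; rewrite /q mulnC divnK.
have q0 := prim_order_gt0 qp.
have pE : perm_eq [seq j <- index_iota 1 n.+1 | (e %| j)%N]
                  [seq (e * k)%N | k <- index_iota 1 q.+1].
  apply: uniq_perm; first by rewrite filter_uniq ?iota_uniq.
    rewrite map_inj_uniq ?iota_uniq // => x y /eqP.
    by rewrite eqn_pmul2l // => /eqP.
  move=> j; rewrite mem_filter mem_index_iota ltnS.
  apply/and3P/mapP => [[/dvdnP[k ->]]|[k]].
    rewrite muln_gt0 => /andP[k0 _] kn.
    by exists k; rewrite ?mem_index_iota ?ltnS 1?mulnC // k0 leq_divRL // mulnC.
  rewrite mem_index_iota ltnS => /andP[k0 kq] ->.
  by rewrite dvdn_mulr // muln_gt0 e0 k0 mulnC -leq_divRL.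
rewrite -big_filter (perm_big _ pE) big_map.
under eq_bigr do rewrite exprM.
(* The known factorization has exponents from 0 to [q - 1], here they run from 1 to [q]; the two end
   factors agree since [(z ^+ e) ^+ q = 1]. *)
rewrite -(factor_Xn_sub_1 qp) big_nat_recr //= [RHS]big_ltn // mulrC.
by rewrite prim_expr_order.
Qed.

(** * The product formulas *)

Section Cyclotomic.
Variables (R : realType) (A : nat -> {fset nat}) (regA : regular_system A).

Let XF (d : nat) : {fraction {poly R[i]}} := ('X^d - 1 : {poly R[i]})%:F.

Let XF_neq0 d : (0 < d)%N -> XF d != 0.
Proof. by move=> d0; rewrite tofrac_eq0 monic_neq0 ?monic_Xn_sub_1. Qed.

Lemma Phi_AS_expz (S : set nat) n : (0 < n)%N ->
  (Phi_AS R A S n)%:F = \prod_(d <- A n) XF d ^ mu_AS A S (n %/ d)%N.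
Proof.
move=> n0; pose L j : {fraction {poly R[i]}} := ('X - (zeta R n ^+ j)%:P)%:F.
have L0 j : L j != 0 by rewrite tofrac_eq0 polyXsubC_eq0.
transitivity (\prod_(1 <= j < n.+1) L j ^ rho S (gcdA A j%:Z n)).
  rewrite /Phi_AS rmorph_prod big_mkcond; apply: eq_bigr => j _.
  by rewrite /rho; case: (_ \in S); rewrite ?expr1z ?expr0z.
under eq_bigr do rewrite rho_gcdA // -expz_sum //.
(* After the exchange, the divisor [e] contributes a power of ['X^(n %/ e) - 1]; reindexing by
   [e = n %/ d] gives the stated form. *)
rewrite (exchange_big_dep predT) //= -(big_regular_compl regA _ _ n0).
rewrite big_seq [RHS]big_seq; apply: eq_bigr => d dA.
have dn := regular_dvd regA n0 dA.
rewrite -prod_expz -rmorph_prod /=; congr (_%:F ^ _).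
rewrite (prod_prim_root_dvd n0 (prim_root_zeta R n0)) ?dvdn_div //.
by rewrite divnA // mulKn.
Qed.

Lemma Phi_A_expz n : (0 < n)%N ->
  (Phi_A R A n)%:F = \prod_(d <- A n) XF d ^ mu_A A (n %/ d)%N.
Proof.
move=> n0; rewrite Phi_AS_expz // big_seq [RHS]big_seq.
apply: eq_bigr => d dA; rewrite mu_AS1 //.
exact: (regular_gt0 regA n0 (regular_compl regA n0 dA)).
Qed.

(** Each change of sign contributes a power of -1, and by [sum_mu_AS] the exponents add up to
    [rho S n]. *)
Lemma prod_expz_subC (S : set nat) n : (0 < n)%N ->
  \prod_(d <- A n) XF d ^ mu_AS A S (n %/ d)%N =
  (-1) ^ rho S n
    * \prod_(d <- A n) (1 - 'X^d : {poly R[i]})%:F ^ mu_AS A S (n %/ d)%N.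
Proof.
move=> n0; rewrite -(sum_mu_AS regA) //.
rewrite -(big_regular_compl regA _ (mu_AS A S) n0).
rewrite -expz_sum ?oppr_eq0 ?oner_eq0 // -big_split; apply: eq_bigr => d _ /=.
by rewrite -expfzMl mulN1r -rmorphN opprB.
Qed.

Lemma prod_Phi_A_cond (S : set nat) n : (0 < n)%N ->
  \prod_(d <- A n | (n %/ d)%N \in S) (Phi_A R A d)%:F =
  \prod_(d <- A n) XF d ^ mu_AS A S (n %/ d)%N.
Proof.
(* By definition [mu_AS] is the convolution of [mu_A] and [rho S]: the inner products are the
   [Phi_A], and the outer exponent [rho S] encodes the condition on [d]. *)
move=> n0; rewrite -(prod_expz_Aconv regA) // big_mkcond.
rewrite big_seq [RHS]big_seq; apply: eq_bigr => d dA.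
rewrite -Phi_A_expz ?(regular_gt0 regA n0 dA) // /rho.
by case: (_ \in S); rewrite ?expr1z ?expr0z.
Qed.

Lemma prod_Phi_AS (S : set nat) n : (0 < n)%N ->
  \prod_(d <- A n) Phi_AS R A S d
    = \prod_(d <- A n | (n %/ d)%N \in S) ('X^d - 1).
Proof.
move=> n0; apply/eqP; rewrite -tofrac_eq !rmorph_prod; apply/eqP.
(* The trivial outer exponent 1 turns the double product into a convolution with the constant 1,
   which sums [mu_AS] back to [rho S]. *)
transitivity (\prod_(d <- A n)
    (\prod_(e <- A d) XF e ^ mu_AS A S (d %/ e)%N) ^ (1 : int)).
  rewrite big_seq [RHS]big_seq; apply: eq_bigr => d dA.
  by rewrite expr1z -Phi_AS_expz ?(regular_gt0 regA n0 dA).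
rewrite (prod_expz_Aconv regA (fun=> 1)) // [RHS]big_mkcond.
rewrite big_seq [RHS]big_seq; apply: eq_bigr => d dA.
have q0 := regular_gt0 regA n0 (regular_compl regA n0 dA).
rewrite /Aconv; under eq_bigr do rewrite mulr1.
by rewrite (sum_mu_AS regA) // /rho; case: (_ \in S); rewrite ?expr1z ?expr0z.
Qed.

Lemma prod_Phi_A n : (0 < n)%N -> \prod_(d <- A n) Phi_A R A d = 'X^n - 1.
Proof.
move=> n0; rewrite prod_Phi_AS // big_mkcond.
rewrite (bigD1_seq n) ?fset_uniq ?regular_self //= divnn n0 mem_set //.
rewrite big_seq_cond big1 ?mulr1 // => d /andP[dA dn].
case: ifP => // /set_mem /= nd; case/eqP: dn.
by rewrite -(divnK (regular_dvd regA n0 dA)) nd mul1n.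
Qed.

End Cyclotomic.

Theorem theorem1 (R : realType) (A : nat -> {fset nat}) (S : set nat) (n : nat)
    (regA : regular_system A)
    (S_nonempty : S !=set0) (S_pos : S `<=` [set k | (0 < k)%N])
    (n_pos : (0 < n)%N) :
  [/\ (Phi_AS R A S n)%:F
        = \prod_(d <- A n) ('X^d - 1 : {poly R[i]})%:F ^ mu_AS A S (n %/ d)%N,
      \prod_(d <- A n) ('X^d - 1 : {poly R[i]})%:F ^ mu_AS A S (n %/ d)%N
        = (-1) ^ rho S n
          * \prod_(d <- A n) (1 - 'X^d : {poly R[i]})%:F ^ mu_AS A S (n %/ d)%N,
      (-1) ^ rho S n
          * \prod_(d <- A n) (1 - 'X^d : {poly R[i]})%:F ^ mu_AS A S (n %/ d)%N
        = \prod_(d <- A n | (n %/ d)%N \in S) (Phi_A R A d)%:F,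
      \prod_(d <- A n) Phi_AS R A S d
        = \prod_(d <- A n | (n %/ d)%N \in S) ('X^d - 1)
    & \prod_(d <- A n) Phi_A R A d = 'X^n - 1].
Proof.
split; [exact: Phi_AS_expz | exact: prod_expz_subC | | exact: prod_Phi_AS |
  exact: prod_Phi_A].
by rewrite prod_Phi_A_cond // prod_expz_subC.
Qed.
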